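(* Let $(G,N,\odot)$ and $(G',N',\odot')$ be (finite) skew bracoids, let $(\varphi,\varphi_N):(G,N,\odot)\to(G',N',\odot')$ be a homomorphism of skew bracoids, and let $M=\ker(\varphi_N)$. Then the reduced forms of the skew bracoids $(G,N/M)$ and $(\mathrm{Im}(\varphi),\mathrm{Im}(\varphi_N))$ are isomorphic skew bracoids.
   Context: All groups are finite. A (left) skew bracoid is a $5$-tuple $(G,\cdot,N,\star,\odot)$, also written $(G,N,\odot)$ or $(G,N)$, such that $(G,\cdot)$ and $(N,\star)$ are groups and $\odot$ is a transitive action of $(G,\cdot)$ on the set $N$ such that $g\odot(\eta\star\mu)=(g\odot\eta)\star(g\odot e_N)^{-1}\star(g\odot\mu)$ for all $g\in G$ and $\eta,\mu\in N$, where $e_N$ is the identity of $N$ and inverses of elements of $N$ are taken in $(N,\star)$. Its $\gamma$-function is the homomorphism $\gamma:G\to\mathrm{Aut}(N)$ given by ${}^{\gamma(g)}\eta=(g\odot e_N)^{-1}\star(g\odot\eta)$. An ideal of $(G,N)$ is a normal subgroup $M$ of $N$ with ${}^{\gamma(G)}M=M$; in that case $G$ acts on $N/M$ by $g\odot(\eta M)=(g\odot\eta)M$ and $(G,N/M)$ is a skew bracoid. A homomorphism of skew bracoids $(G,N,\odot)\to(G',N',\odot')$ is a pair of group homomorphisms $\varphi:G\to G'$ and $\varphi_N:N\to N'$ such that $\varphi_N(g\odot\eta)=\varphi(g)\odot'\varphi_N(\eta)$ for all $g\in G$, $\eta\in N$; it is an isomorphism if both $\varphi$ and $\varphi_N$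 are isomorphisms. For a homomorphism, $\ker(\varphi_N)$ is an ideal of $(G,N)$, and $(\mathrm{Im}(\varphi),\mathrm{Im}(\varphi_N))$ with the restriction of $\odot'$ is a skew bracoid. Let $\lambda_\odot:G\to\mathrm{Perm}(N)$ be the permutation representation of $\odot$. The reduced form of $(G,N)$ is the skew bracoid $(\bar G,N)$, where $\bar G=G/\ker(\lambda_\odot)$ acts on $N$ by $(g\ker(\lambda_\odot))\odot\eta=g\odot\eta$. *)

(* Defs.v *)
From mathcomp Require Import all_boot all_fingroup.

Set Implicit Arguments.
Unset Strict Implicit.
Unset Printing Implicit Defensive.

Local Open Scope group_scope.

(* Groups are given as subgroups of ambient finGroupTypes; [bact] is a *left*
   action of G on the set N (MathComp's own actions are right actions), and its
   values outside of G and N are irrelevant. *)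
Record skew_bracoid (gT nT : finGroupType) (G : {group gT}) (N : {group nT}) :=
  SkewBracoid {
    bact : gT -> nT -> nT;
    bact_closed : {in G & N, forall g eta, bact g eta \in N};
    bact1 : {in N, forall eta, bact 1 eta = eta};
    bactM : {in G & G & N, forall g h eta,
               bact (g * h) eta = bact g (bact h eta)};
    bact_trans : {in N &, forall eta mu, exists2 g, g \in G & bact g eta = mu};
    bact_mul : {in G & N & N, forall g eta mu,
                  bact g (eta * mu) = bact g eta * (bact g 1)^-1 * bact g mu}
  }.

Section Bracoid.

Variables (gT nT : finGroupType) (G : {group gT}) (N : {group nT}).
Variable B : skew_bracoid G N.

Definition gamma (g : gT) (eta : nT) : nT := (bact B g 1)^-1 * bact B g eta.

Definition ideal (M : {group nT}) : Prop :=
  M <| N /\ {in G, forall g, gamma g @: M = M}.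

Lemma gammaM : {in G & N & N, forall g eta mu,
  gamma g (eta * mu) = gamma g eta * gamma g mu}.
Proof. by move=> g x y gG xN yN; rewrite /gamma bact_mul // !mulgA. Qed.

Lemma gamma_closed : {in G & N, forall g eta, gamma g eta \in N}.
Proof.
by move=> g x gG xN; rewrite /gamma groupM ?groupV ?bact_closed ?group1.
Qed.

Lemma bact_gamma g eta : bact B g eta = bact B g 1 * gamma g eta.
Proof. by rewrite /gamma mulKVg. Qed.

Section Quotient.

Variables (M : {group nT}) (idM : ideal M).

(* g (eta M) = (g eta) M, computed on a representative of the coset; independence
   of the representative is [quotient_bactE]. *)
Definition quotient_bact (g : gT) (x : coset_of M) : coset_of M :=
  coset M (bact B g (repr x)).

Let sNM : N \subset 'N(M). Proof. by case: idM => /andP[]. Qed.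
Let sMN : M \subset N. Proof. by case: idM => /andP[]. Qed.

Lemma quotient_bactE :
  {in G & N, forall g eta, quotient_bact g (coset M eta) = coset M (bact B g eta)}.
Proof.
move=> g x gG xN; have [_ /(_ g gG) gM] := idM.
have xNM := subsetP sNM x xN.
have : repr (coset M x) \in M :* x.
  by rewrite -val_coset // mem_repr_coset.
case/rcosetP=> m mM rE; rewrite /quotient_bact rE.
have mN := subsetP sMN m mM.
have gmM : gamma g m \in M.
  by have := imset_f (gamma g) mM; rewrite gM.
have inN y : y \in N -> bact B g y \in 'N(M).
  by move=> yN; apply: (subsetP sNM); apply: bact_closed.
have ginN y : y \in N -> gamma g y \in 'N(M).
  by move=> yN; apply: (subsetP sNM); apply: gamma_closed.
rewrite bact_gamma gammaM // [in RHS]bact_gamma.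
have /= cM := morphM (coset_morphism M).
rewrite cM ?inN ?group1 //; last by rewrite groupM ?ginN.
rewrite (cM (gamma g m)) ?ginN // (coset_id gmM) mul1g.
by rewrite -cM ?inN ?ginN ?group1.
Qed.

Lemma quotient_bact_closed :
  {in G & N / M, forall g x, quotient_bact g x \in N / M}.
Proof.
move=> g _ gG /morphimP[x _ xN ->]; rewrite quotient_bactE //.
by apply: mem_quotient; apply: bact_closed.
Qed.

Lemma quotient_bact1 : {in N / M, forall x, quotient_bact 1 x = x}.
Proof. by move=> _ /morphimP[x _ xN ->]; rewrite quotient_bactE ?bact1. Qed.

Lemma quotient_bactM : {in G & G & N / M, forall g h x,
  quotient_bact (g * h) x = quotient_bact g (quotient_bact h x)}.
Proof.
move=> g h _ gG hG /morphimP[x _ xN ->].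
rewrite (quotient_bactE hG xN) !quotient_bactE ?groupM ?bactM //.
exact: bact_closed.
Qed.

Lemma quotient_bact_trans :
  {in N / M &, forall x y, exists2 g, g \in G & quotient_bact g x = y}.
Proof.
move=> _ _ /morphimP[x _ xN ->] /morphimP[y _ yN ->].
have [g gG <-] := bact_trans B xN yN.
by exists g; rewrite ?quotient_bactE.
Qed.

Lemma quotient_bact_mul : {in G & N / M & N / M, forall g x y,
  quotient_bact g (x * y)
  = quotient_bact g x * (quotient_bact g 1)^-1 * quotient_bact g y}.
Proof.
move=> g _ _ gG /morphimP[x xM xN ->] /morphimP[y yM yN ->].
rewrite -(morph1 (coset M)) -morphM // !quotient_bactE ?groupM ?group1 //.
have inN z : z \in N -> bact B g z \in 'N(M).
  by move=> zN; apply: (subsetP sNM); apply: bact_closed.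
by rewrite bact_mul // !morphM ?morphV ?groupM ?groupV ?inN ?group1.
Qed.

Definition quotient_bracoid : skew_bracoid G (N / M) :=
  SkewBracoid quotient_bact_closed quotient_bact1 quotient_bactM
    quotient_bact_trans quotient_bact_mul.

End Quotient.

(* The kernel of the permutation representation G -> Perm(N) of the action. *)
Definition lambda_ker : {set gT} :=
  [set g in G | [forall eta in N, bact B g eta == eta]].

Lemma lambda_kerP g :
  reflect (g \in G /\ {in N, forall eta, bact B g eta = eta}) (g \in lambda_ker).
Proof.
rewrite inE; apply: (iffP andP) => -[gG H]; split=> //.
  by move=> x xN; apply/eqP; apply: (forall_inP H).
by apply/forall_inP=> x xN; rewrite H.
Qed.

Lemma lambda_ker_group_set : group_set lambda_ker.
Proof.
apply/group_setP; split.
  by apply/lambda_kerP; split=> // x xN; rewrite bact1.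
move=> g h /lambda_kerP[gG gE] /lambda_kerP[hG hE].
by apply/lambda_kerP; split=> [|x xN]; rewrite ?groupM ?bactM ?hE ?gE.
Qed.
Canonical lambda_ker_group := Group lambda_ker_group_set.

Lemma lambda_ker_normal : lambda_ker <| G.
Proof.
apply/normalP; split; first by apply/subsetP=> g /lambda_kerP[].
have sub g : g \in G -> lambda_ker :^ g \subset lambda_ker.
  move=> gG; apply/subsetP=> _ /imsetP[k /lambda_kerP[kG kE] ->].
  apply/lambda_kerP; split=> [|x xN]; first by rewrite groupJ.
  rewrite conjgE !bactM ?groupM ?groupV // kE ?bact_closed //.
  by rewrite -bactM ?groupV // mulVg bact1.
move=> g gG; apply/eqP; rewrite eqEsubset sub //=.
by rewrite -sub_conjgV sub ?groupV.
Qed.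

(* Again through a representative, see [reduced_bactE]. *)
Definition reduced_bact (x : coset_of lambda_ker) (eta : nT) : nT :=
  bact B (repr x) eta.

Lemma reduced_bactE : {in G & N, forall g eta,
  reduced_bact (coset lambda_ker g) eta = bact B g eta}.
Proof.
move=> g x gG xN; have gN := subsetP (normal_norm lambda_ker_normal) g gG.
have : repr (coset lambda_ker g) \in lambda_ker :* g.
  by rewrite -val_coset // mem_repr_coset.
case/rcosetP=> k /lambda_kerP[kG kE] rE.
by rewrite /reduced_bact rE bactM ?kE ?bact_closed.
Qed.

Lemma reduced_bact_closed :
  {in G / lambda_ker & N, forall x eta, reduced_bact x eta \in N}.
Proof.
by move=> _ y /morphimP[g _ gG ->] yN; rewrite reduced_bactE ?bact_closed.
Qed.

Lemma reduced_bact1 : {in N, forall eta, reduced_bact 1 eta = eta}.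
Proof.
by move=> y yN; rewrite -(morph1 (coset lambda_ker)) reduced_bactE ?bact1.
Qed.

Lemma reduced_bactM : {in G / lambda_ker & G / lambda_ker & N, forall x y eta,
  reduced_bact (x * y) eta = reduced_bact x (reduced_bact y eta)}.
Proof.
move=> _ _ z /morphimP[g gN gG ->] /morphimP[h hN hG ->] zN.
by rewrite -morphM // !reduced_bactE ?groupM ?bactM ?bact_closed.
Qed.

Lemma reduced_bact_trans : {in N &, forall eta mu,
  exists2 x, x \in G / lambda_ker & reduced_bact x eta = mu}.
Proof.
move=> x y xN yN; have [g gG <-] := bact_trans B xN yN.
by exists (coset lambda_ker g); rewrite ?mem_quotient ?reduced_bactE.
Qed.

Lemma reduced_bact_mul : {in G / lambda_ker & N & N, forall x eta mu,
  reduced_bact x (eta * mu)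
  = reduced_bact x eta * (reduced_bact x 1)^-1 * reduced_bact x mu}.
Proof.
move=> _ y z /morphimP[g _ gG ->] yN zN.
by rewrite !reduced_bactE ?groupM ?group1 ?bact_mul.
Qed.

Definition reduced_form : skew_bracoid (G / lambda_ker) N :=
  SkewBracoid reduced_bact_closed reduced_bact1 reduced_bactM
    reduced_bact_trans reduced_bact_mul.

End Bracoid.

Section Homomorphism.

Variables (gT nT gT' nT' : finGroupType).
Variables (G : {group gT}) (N : {group nT}).
Variables (G' : {group gT'}) (N' : {group nT'}).
Variables (B : skew_bracoid G N) (B' : skew_bracoid G' N').

(* MathComp morphisms carry only their domain, hence the codomain conditions. *)
Definition bracoid_hom
    (phi : {morphism G >-> gT'}) (phiN : {morphism N >-> nT'}) : Prop :=
  [/\ phi @* G \subset G', phiN @* N \subset N'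
    & {in G & N, forall g eta,
         phiN (bact B g eta) = bact B' (phi g) (phiN eta)}].

Definition bracoid_isog : Prop :=
  exists (phi : {morphism G >-> gT'}) (phiN : {morphism N >-> nT'}),
    [/\ bracoid_hom phi phiN, isom G G' phi & isom N N' phiN].

Variables (phi : {morphism G >-> gT'}) (phiN : {morphism N >-> nT'}).
Hypothesis hom : bracoid_hom phi phiN.

Let homE : {in G & N, forall g eta,
  phiN (bact B g eta) = bact B' (phi g) (phiN eta)}.
Proof. by case: hom. Qed.
Let im_phi g : g \in G -> phi g \in G'.
Proof.
by case: hom => /subsetP sG _ _ gG; apply: sG; apply: mem_morphim.
Qed.
Let im_phiN x : x \in N -> phiN x \in N'.
Proof.
by case: hom => _ /subsetP sN _ xN; apply: sN; apply: mem_morphim.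
Qed.

Lemma ker_ideal : ideal B ('ker phiN).
Proof.
split=> [|g gG]; first exact: ker_normal.
have inN x : x \in N -> bact B g x \in N by move=> xN; apply: bact_closed.
apply/eqP; rewrite eqEcard; apply/andP; split; last first.
  rewrite card_in_imset // => x y /(subsetP (normal_sub (ker_normal _))) xN.
  move=> /(subsetP (normal_sub (ker_normal _))) yN /mulgI gxy.
  by rewrite -(bact1 B xN) -(bact1 B yN) -(mulVg g) !bactM ?groupV ?gxy.
apply/subsetP=> _ /imsetP[x /morphpreP[xN /set1P x1] ->].
have gxN : gamma B g x \in N by apply: gamma_closed.
apply/kerP => //.
rewrite /gamma morphM ?groupV ?inN ?group1 // morphV ?inN ?group1 //.
by rewrite !homE ?group1 // x1 morph1 mulVg.
Qed.

Lemma image_bact_closed : {in phi @* G & phiN @* N, forall g eta,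
  bact B' g eta \in phiN @* N}.
Proof.
move=> _ _ /morphimP[g _ gG ->] /morphimP[x _ xN ->].
by rewrite -homE // mem_morphim // bact_closed.
Qed.

Lemma image_bact1 : {in phiN @* N, forall eta, bact B' 1 eta = eta}.
Proof. by move=> _ /morphimP[x _ xN ->]; rewrite bact1 ?im_phiN. Qed.

Lemma image_bactM : {in phi @* G & phi @* G & phiN @* N, forall g h eta,
  bact B' (g * h) eta = bact B' g (bact B' h eta)}.
Proof.
move=> _ _ _ /morphimP[g _ gG ->] /morphimP[h _ hG ->] /morphimP[x _ xN ->].
by rewrite bactM ?im_phi ?im_phiN.
Qed.

Lemma image_bact_trans : {in phiN @* N &, forall eta mu,
  exists2 g, g \in phi @* G & bact B' g eta = mu}.
Proof.
move=> _ _ /morphimP[x _ xN ->] /morphimP[y _ yN ->].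
have [g gG <-] := bact_trans B xN yN.
by exists (phi g); rewrite ?mem_morphim ?homE.
Qed.

Lemma image_bact_mul : {in phi @* G & phiN @* N & phiN @* N, forall g eta mu,
  bact B' g (eta * mu) = bact B' g eta * (bact B' g 1)^-1 * bact B' g mu}.
Proof.
move=> _ _ _ /morphimP[g _ gG ->] /morphimP[x _ xN ->] /morphimP[y _ yN ->].
by rewrite bact_mul ?im_phi ?im_phiN.
Qed.

Definition image_bracoid : skew_bracoid (phi @* G) (phiN @* N) :=
  SkewBracoid image_bact_closed image_bact1 image_bactM
    image_bact_trans image_bact_mul.

End Homomorphism.

(* Main.v *)
(* The isomorphism N / ker phiN -> phiN(N) induced by phiN turns the action of g
   into that of phi g, so g acts trivially on N / ker phiN iff phi g acts
   trivially on phiN(N). Hence the kernel of the composite G -> phi(G) ->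
   phi(G) / lambda_ker is the lambda_ker of (G, N / ker phiN), and the first
   isomorphism theorem applies on both components. *)

Require Import Defs.
From mathcomp Require Import all_boot all_fingroup.

Local Open Scope group_scope.

(* Unlike [first_isom], this records the values of the isomorphism and lets [K]
   be only provably equal to the kernel. *)
Lemma first_isomE (aT rT : finGroupType) (G K : {group aT})
    (f : {morphism G >-> rT}) :
  K = 'ker f :> {set aT} ->
  exists2 g : {morphism G / K >-> rT},
    isom (G / K) (f @* G) g & {in G, forall x, g (coset K x) = f x}.
Proof.
move=> kerE; have nKG : G \subset 'N(K) by rewrite kerE; exact: ker_norm.
have kerq : 'ker (coset K) = 'ker f by rewrite ker_coset kerE.
have sKq : 'ker (coset K) \subset 'ker f by rewrite kerq.
exists [morphism of factm sKq nKG]; last by move=> x xG; exact: factmE.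
by apply/isomP; split; [exact/injm_factmP | exact: morphim_factm].
Qed.

Theorem theorem4p11
    (gT nT gT' nT' : finGroupType)
    (G : {group gT}) (N : {group nT}) (G' : {group gT'}) (N' : {group nT'})
    (B : skew_bracoid G N) (B' : skew_bracoid G' N')
    (phi : {morphism G >-> gT'}) (phiN : {morphism N >-> nT'})
    (hom : bracoid_hom B B' phi phiN) :
  bracoid_isog (reduced_form (quotient_bracoid (ker_ideal hom)))
               (reduced_form (image_bracoid hom)).
Proof.
set Q := quotient_bracoid _; set I := image_bracoid hom.
have [_ _ homE] := hom.
have [gN isoN gNE] := @first_isomE _ _ N ('ker phiN)%G phiN erefl.
have [/injmP injN imN] := isomP isoN.
have phiI x : x \in G -> phi x \in phi @* G by move=> xG; exact: mem_morphim.
(* [coset] is multiplicative only on the normaliser and defaults to 1 outside it, so both [fM] and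
   the computation of ['ker f] rely on this. *)
have nI x : x \in G -> phi x \in 'N(lambda_ker I).
  by move=> /phiI; apply: (subsetP (normal_norm (lambda_ker_normal I))).
have fM : {in G &, {morph (fun x => coset (lambda_ker I) (phi x)) : x y / x * y}}.
  by move=> x y xG yG /=; rewrite morphM // morphM ?nI.
pose f := Morphism fM.
have QE : {in G & N, forall x n,
    bact Q x (coset ('ker phiN) n) = coset ('ker phiN) (bact B x n)}.
  exact: (quotient_bactE (ker_ideal hom)).
have kerE : lambda_ker Q = 'ker f.
  apply/setP=> x; apply/lambda_kerP/idP => [[xG xE]|].
    apply/kerP=> //; apply: coset_id; apply/lambda_kerP; split; first exact: phiI.
    (* Pulled back along [gN], the claim becomes the triviality of [x] on a coset. *)
    move=> _ /morphimP[n _ nN ->]; rewrite /= -homE // -gNE ?bact_closed //.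
    by rewrite -QE // xE ?mem_quotient ?gNE.
  move=> xK; have xG := dom_ker xK; split=> // _ /morphimP[n _ nN ->].
  have /lambda_kerP[_ xE] : phi x \in lambda_ker I.
    by apply: coset_idr; [exact: nI | exact: (mker xK)].
  (* Conversely, injectivity of [gN] reflects the equality from [phiN @* N] to cosets. *)
  apply: injN; rewrite ?QE ?mem_quotient ?bact_closed //.
  rewrite !gNE ?bact_closed // homE //.
  by apply: xE; exact: mem_morphim.
have [g isoG gE] := @first_isomE _ _ G (lambda_ker_group Q) f kerE.
(* This makes [g] surjective onto the group of the second reduced form. *)
have imf : f @* G = phi @* G / lambda_ker I.
  apply/setP=> y; apply/morphimP/morphimP => [[x _ xG ->]|[_ _ /morphimP[x _ xG ->] ->]].
    by exists (phi x); rewrite ?nI ?phiI.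
  by exists x.
exists g, gN; split=> //; last by move: isoG; rewrite imf.
have [_ img] := isomP isoG.
split; [by rewrite /= (etrans img imf) | by rewrite imN |].
(* Equivariance on representatives: both sides reduce to [bact B' (phi x) (phiN n)]. *)
move=> _ _ /morphimP[x _ xG ->] /morphimP[n _ nN ->].
have nQ : coset ('ker phiN) n \in N / 'ker phiN by exact: mem_quotient.
have nIm : phiN n \in phiN @* N by exact: mem_morphim.
rewrite [bact (reduced_form Q) _ _]reduced_bactE // QE // gE // !gNE ?bact_closed //.
by rewrite [RHS]reduced_bactE ?phiI // homE.
Qed.
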